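(* Let $(S,\tau)$ be a semitopological semigroup, let $\theta\colon S\to H(1_S)$ be a continuous homomorphism, and let $(\mathscr{B}(S,\mathbb{Z},\theta),\tau_{\mathbf{BR}})$ be a topological $\mathbb{Z}$-Bruck-Reilly extension of $(S,\tau)$ in the class of semitopological semigroups. If $S$ contains a left (or right, or two-sided) compact ideal, then $\tau_{\mathbf{BR}}$ is the direct sum topology $\tau_{\mathbf{BR}}^{\mathbf{ds}}$ on $\mathscr{B}(S,\mathbb{Z},\theta)$.
   Context: All topological spaces are Hausdorff. A semitopological semigroup is a (Hausdorff) topological space with a separately continuous semigroup operation. Ideals are nonempty. Convention: $S$ always has a unit $1_S$; a semigroup without unit is replaced by the monoid $S^1$ obtained by adjoining an isolated unit, so $S=S^1$. $H(1_S)$ is the group of units of $S$, with the subspace topology. For a homomorphism $\theta\colon S\to H(1_S)$ let $\theta^n$ be its $n$-fold composition, $\theta^0=\mathrm{id}_S$. The $\mathbb{Z}$-Bruck-Reilly extension $\mathscr{B}(S,\mathbb{Z},\theta)$ is the set $\mathbb{Z}\times S\times\mathbb{Z}$ with the semigroup operation $$(i,s,j)\cdot(m,t,n)=\begin{cases}(i-j+m,\theta^{m-j}(s)\cdot t,n), & j<m,\\ (i,s\cdot t,n), & j=m,\\ (i,s\cdot\theta^{j-m}(t),n-m+j), & j>m.\end{cases}$$ For $m,n\in\mathbb{Z}$ put $S_{m,n}=\{(m,s,n)\colon s\in S\}$. The direct sum topology $\tau_{\mathbf{BR}}^{\mathbf{ds}}$ is the product topology on $\mathbb{Z}\times S\times\mathbb{Z}$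 with $\mathbb{Z}$ discrete, i.e. the topology with base $\{\{i\}\times U\times\{j\}\colon U\in\tau,\ i,j\in\mathbb{Z}\}$. A topological $\mathbb{Z}$-Bruck-Reilly extension of $(S,\tau)$ in a class $\mathfrak{S}$ of semitopological semigroups (with $(S,\tau)\in\mathfrak{S}$) is a semigroup $(\mathscr{B}(S,\mathbb{Z},\theta),\tau_{\mathbf{BR}})\in\mathfrak{S}$, where $\theta$ is continuous and, for some $m\in\mathbb{Z}$, the restriction of $\tau_{\mathbf{BR}}$ to $S_{m,m}$ coincides with $\tau$ under the identification $(m,s,m)\leftrightarrow s$. *)

(* Defs.v *)
From HB Require Import structures.
From mathcomp Require Import all_boot all_order all_algebra.
From mathcomp Require Import zify.
From mathcomp Require Import all_classical.
From mathcomp Require Import topology_structure separation_axioms compact.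
From mathcomp Require Import initial_topology subtype_topology.
From mathcomp Require Import product_topology discrete_topology.

Set Implicit Arguments.
Unset Strict Implicit.
Unset Printing Implicit Defensive.

Import Order.TTheory GRing.Theory Num.Theory.

Local Open Scope classical_set_scope.
Local Open Scope group_scope.

(* A topology on a type [T] is an inhabitant of the library class
   [Topological T]; [tspace tau] is the corresponding topological space.
   The class also carries a choice structure on [T], so two topologies are
   compared through [opens], not by Leibniz equality. *)
Definition tspace (T : Type) (tau : Topological T) : topologicalType :=
  Topological.Pack tau.

Definition opens (T : Type) (tau : Topological T) : set (set T) :=
  @open (tspace tau).

Definition semitopological_semigroup (S : semigroupType) (tau : Topological S) :
    Prop :=
  [/\ hausdorff_space (tspace tau),
      forall a : S, continuous ((fun x => a * x) : tspace tau -> tspace tau) &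
      forall a : S, continuous ((fun x => x * a) : tspace tau -> tspace tau)].

Definition left_ideal (S : semigroupType) (I : set S) : Prop :=
  I !=set0 /\ forall s x, I x -> I (s * x).

Definition right_ideal (S : semigroupType) (I : set S) : Prop :=
  I !=set0 /\ forall s x, I x -> I (x * s).

Definition two_sided_ideal (S : semigroupType) (I : set S) : Prop :=
  left_ideal I /\ right_ideal I.

Section UnitGroup.
Variable S : monoidType.

Definition units : set S := [set x | exists y, x * y = 1 /\ y * x = 1].

Definition unit_group : Type := set_type units.

HB.instance Definition _ := SubChoice.on unit_group.

Lemma units_monoid_closed : monoid_closed (mem units).
Proof.
split; first by rewrite inE; exists 1; rewrite mulg1.
move=> x y; rewrite !inE => -[x' [xx' x'x]] [y' [yy' y'y]].
exists (y' * x'); split.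
  by rewrite -mulgA (mulgA y) yy' mul1g.
by rewrite -mulgA (mulgA x') x'x mul1g.
Qed.

HB.instance Definition _ :=
  SubChoice_isSubMonoid.Build S (mem units) unit_group units_monoid_closed.

Lemma unit_inverse (x : unit_group) :
  {y : unit_group | y * x = 1 /\ x * y = 1}.
Proof.
apply: cid; have : units (val x) by apply/set_mem/(valP x).
move=> [y [xy yx]].
have uy : y \in units by rewrite inE; exists (val x).
exists (exist _ y uy : unit_group).
by split; apply: val_inj; rewrite valM val1.
Qed.

Let unit_inv (x : unit_group) : unit_group := sval (unit_inverse x).

Let unit_mulVg : left_inverse 1 unit_inv *%g.
Proof. by move=> x; case: (svalP (unit_inverse x)). Qed.

Let unit_mulgV : right_inverse 1 unit_inv *%g.
Proof. by move=> x; case: (svalP (unit_inverse x)). Qed.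

HB.instance Definition _ := hasInv.Build unit_group unit_inv.
HB.instance Definition _ :=
  Monoid_isGroup.Build unit_group unit_mulVg unit_mulgV.

End UnitGroup.

Definition unit_space (S : monoidType) (tau : Topological S) : topologicalType :=
  initial_topology (val : unit_group S -> tspace tau).

(* [theta] is a phantom parameter: it lets the type carry its multiplication. *)
Definition ZBruckReilly (S : monoidType)
  (theta : {multiplicative S -> unit_group S}) : Type := (int * S * int)%type.

Section ZBruckReilly.
Variables (S : monoidType) (theta : {multiplicative S -> unit_group S}).

Definition theta_iter (n : nat) : S -> S := iter n (fun s => val (theta s)).

Definition ZBR_mul (x y : ZBruckReilly theta) : ZBruckReilly theta :=
  let: (i, s, j) := x in
  let: (m, t, n) := y in
  if (j < m)%R then ((i - j + m)%R, theta_iter `|m - j|%N s * t, n)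
  else if j == m then (i, s * t, n)
  else (i, s * theta_iter `|j - m|%N t, (n - m + j)%R).

Lemma theta_iterM n : {morph theta_iter n : s t / s * t}.
Proof.
elim: n => // n IHn s t.
by rewrite /theta_iter !iterS -!/(theta_iter n _) IHn gmulfM valM.
Qed.

Lemma theta_iterD m n s : theta_iter (m + n) s = theta_iter m (theta_iter n s).
Proof. exact: iterD. Qed.

Lemma ZBR_mulE i s j m t n (p : int) : p = Num.max j m ->
  ZBR_mul (i, s, j) (m, t, n) =
  ((i + (p - j))%R, theta_iter `|p - j|%N s * theta_iter `|p - m|%N t,
   (n + (p - m))%R).
Proof.
move=> ->; rewrite /ZBR_mul; case: (ltgtP j m) => [_|_|<-];
  rewrite ?subrr ?addr0 //=.
- by congr (_, _, _); lia.
- by congr (_, _, _); lia.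
Qed.

Lemma ZBR_mulA : associative ZBR_mul.
Proof.
move=> [[i s] j] [[m t] n] [[k u] l].
have [r rE] : {r : int | r = Num.max (j + n)%R (Num.max (m + n) (m + k))%R}.
  by eexists.
rewrite (@ZBR_mulE m t n k u l (Num.max n k)) //.
rewrite (@ZBR_mulE i s j m t n (Num.max j m)) //.
rewrite (@ZBR_mulE i s j _ _ _ (r - n)%R); last by lia.
rewrite (@ZBR_mulE _ _ _ k u l (r - m)%R); last by lia.
rewrite !theta_iterM -!theta_iterD mulgA.
congr (_, theta_iter _ _ * theta_iter _ _ * theta_iter _ _, _); lia.
Qed.

HB.instance Definition _ := Choice.on (ZBruckReilly theta).
HB.instance Definition _ := isSemigroup.Build (ZBruckReilly theta) ZBR_mulA.

Definition ZBR_block (m n : int) : set (ZBruckReilly theta) :=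
  [set x | exists s : S, x = (m, s, n)].

Definition direct_sum_topology (tau : Topological S) :
    Topological (ZBruckReilly theta) :=
  Topological.class
    (discrete_topology int * tspace tau * discrete_topology int)%type.

End ZBruckReilly.

Arguments ZBR_block {S} theta m n.

(* Under [s <-> (m, s, m)], the subspace topology induced by [tauBR] on the
   block [S_(m,m)] is [tau]. *)
Definition restricts_to (S : monoidType)
    (theta : {multiplicative S -> unit_group S}) (tau : Topological S)
    (tauBR : Topological (ZBruckReilly theta)) (m : int) : Prop :=
  forall V : set S, opens tau V <->
    exists U : set (ZBruckReilly theta), opens tauBR U /\
      [set ((m, s, m) : ZBruckReilly theta) | s in V] =
      U `&` ZBR_block theta m m.

Definition topological_ZBR_extension
    (C : forall X : semigroupType, Topological X -> Prop) (S : monoidType)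
    (tau : Topological S) (theta : {multiplicative S -> unit_group S})
    (tauBR : Topological (ZBruckReilly theta)) : Prop :=
  [/\ C S tau,
      continuous (theta : tspace tau -> unit_space tau),
      C (ZBruckReilly theta) tauBR &
      exists m : int, restricts_to tau tauBR m].

(* Main.v *)
Require Import Defs.
From mathcomp Require Import all_boot all_order all_algebra zify.
From mathcomp Require Import all_classical.
From mathcomp Require Import topology_structure separation_axioms compact.
From mathcomp Require Import subspace_topology product_topology.
From mathcomp Require Import discrete_topology.

(** The semigroup [B = ZBruckReilly theta] carries shifts: multiplying by
    [(i, 1, k)] on the left and by [(l, 1, j)] on the right maps the block
    [S_(k,l)] bijectively onto [S_(i,j)], inversely to another such map.  By
    separate continuity all blocks are therefore copies of the one block on
    which the topology of [B] is known to be [tau].  Hence open sets have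
    [tau]-open traces on the blocks ([open_block_trace]), and in an open block
    every [tau]-open set is open in [B] ([open_block_of_slice]).  Since the
    open sets of the direct sum topology are the sets with [tau]-open traces
    ([opens_direct_sumP]), it remains to show that all blocks are open.

    Two facts make the blocks open.  First, by Hausdorffness, the elements not
    fixed by multiplication by the idempotent [(k, 1, k)] form an open set, so
    the conditions that the first coordinate is at most [i], and that the last
    one is at most [j], are open.  Imposing them on [x], on
    [(i, 1, i) * x] and on [x * (j, 1, j)] shows that the diagonal ray
    [{(i - k, s, j - k) | k >= 0}] is open ([open_lower_diagonal]).

    Second, the part of this ray with [k > 0] can be cut off when there is a
    compact left ideal [I].  Choose [c] in [I] and multiply on the right by
    [(j - 1, c, j - 1)].  Every [(i - k, s, j - k)] with [k > 0] is sent to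
    [(i - 1, t * c, j - 1)] for some [t], hence into the copy of [I] in
    [S_(i-1,j-1)], which is compact and therefore closed, whereas [S_(i,j)]
    stays in itself.  So [S_(i,j)] is the intersection of the ray with the
    preimage of an open set.  For a right ideal, multiply on the left. *)

Set Implicit Arguments.
Unset Strict Implicit.
Unset Printing Implicit Defensive.

Import Order.TTheory GRing.Theory Num.Theory.
Local Open Scope classical_set_scope.
Local Open Scope group_scope.

(** * Products in the Bruck-Reilly extension *)

Section Multiplication.
Variables (S : monoidType) (theta : {multiplicative S -> unit_group S}).
Local Notation B := (ZBruckReilly theta).
Local Notation point i s j := ((i, s, j) : B).

Lemma theta_iter1 n : theta_iter theta n 1 = 1.
Proof.
(* [theta] maps into a group, where the idempotent [theta 1] must be [1]. *)
elim: n => // n IHn; rewrite /theta_iter iterS -/(theta_iter theta n 1) IHn.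
have -> : theta 1 = 1.
  by apply: (mulgI (theta 1)); rewrite -gmulfM !mulg1.
by rewrite val1.
Qed.

Lemma ZBR_mul_eq (i k j : int) (s t : S) :
  point i s k * point k t j = point i (s * t) j.
Proof. by rewrite -[LHS]/(ZBR_mul _ _) /ZBR_mul ltxx eqxx. Qed.

Lemma ZBR_mul_lt (i j m n : int) (s t : S) : (j < m)%R ->
  point i s j * point m t n =
  point (i + (m - j))%R (theta_iter theta `|m - j|%N s * t) n.
Proof.
move=> jm; have -> : (i + (m - j) = i - j + m)%R by lia.
by rewrite -[LHS]/(ZBR_mul _ _) /ZBR_mul jm.
Qed.

Lemma ZBR_mul_gt (i j m n : int) (s t : S) : (m < j)%R ->
  point i s j * point m t n =
  point i (s * theta_iter theta `|j - m|%N t) (n + (j - m))%R.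
Proof.
move=> mj; have -> : (n + (j - m) = n - m + j)%R by lia.
by rewrite -[LHS]/(ZBR_mul _ _) /ZBR_mul ltNge (ltW mj) gt_eqF.
Qed.

Lemma idem_mul_le (k i j : int) (s : S) : (k <= i)%R ->
  point k 1 k * point i s j = point i s j.
Proof.
rewrite le_eqVlt => /predU1P[->|ki]; first by rewrite ZBR_mul_eq mul1g.
by rewrite ZBR_mul_lt // theta_iter1 mul1g addrC subrK.
Qed.

Lemma mul_idem_le (k i j : int) (s : S) : (k <= j)%R ->
  point i s j * point k 1 k = point i s j.
Proof.
rewrite le_eqVlt => /predU1P[->|kj]; first by rewrite ZBR_mul_eq mulg1.
by rewrite ZBR_mul_gt // theta_iter1 mulg1 addrC subrK.
Qed.

End Multiplication.

(** * Topology of the extension *)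

Lemma open_neq (T U : topologicalType) (f g : T -> U) :
  hausdorff_space U -> continuous f -> continuous g ->
  open [set x | f x <> g x].
Proof.
rewrite open_hausdorff => hU cf cg; rewrite openE => x /eqP /hU[[V W] /=].
rewrite !inE => -[Vfx Wgx] [oV oW VW0].
have nV : nbhs x (f @^-1` V) by apply: cf; apply: open_nbhs_nbhs.
have nW : nbhs x (g @^-1` W) by apply: cg; apply: open_nbhs_nbhs.
apply: filterS (filterI nV nW).
move=> y [/= Vfy Wgy] fg.
have : (V `&` W) (f y) by split; rewrite // fg.
by rewrite VW0.
Qed.

Section Extension.
Variables (S : monoidType) (tau : Topological S).
Variables (theta : {multiplicative S -> unit_group S}).
Variables (tauBR : Topological (ZBruckReilly theta)).
Local Notation B := (ZBruckReilly theta).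
Local Notation T := (tspace tauBR).
Local Notation point i s j := ((i, s, j) : B).
Hypothesis semitopBR : semitopological_semigroup tauBR.

Let hT : hausdorff_space T. Proof. by case: semitopBR. Qed.
Let cl (a : B) : continuous ((fun x => a * x) : T -> T).
Proof. by case: semitopBR. Qed.
Let cr (a : B) : continuous ((fun x => x * a) : T -> T).
Proof. by case: semitopBR. Qed.

Lemma continuous_mul_sides (X : topologicalType) (f : X -> T) (a b : B) :
  continuous f -> continuous ((fun x => a * f x * b) : X -> T).
Proof.
move=> cf x.
exact: (continuous_comp (continuous_comp (cf x) (@cl a _)) (@cr b _)).
Qed.

(** The elements with first coordinate above [i] are those fixed by left
    multiplication by the idempotent [(i + 1, 1, i + 1)]. *)
Lemma open_fst_le (i : int) : open ([set x : B | (x.1.1 <= i)%R] : set T).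
Proof.
rewrite (_ : mkset _ = [set x : T | point (i + 1)%R 1 (i + 1)%R * x <> x]).
  by apply: (@open_neq T T
    ( *%g (point (i + 1)%R 1 (i + 1)%R)) id) => // x;
    exact: cvg_id.
apply/seteqP; split=> -[[a s] b] /=.
  by move=> ai; rewrite ZBR_mul_gt ?ltzD1 //; case=> *; lia.
move=> ne; rewrite leNgt -lezD1; apply/negP => le1; apply: ne.
exact: idem_mul_le.
Qed.

Lemma open_snd_le (j : int) : open ([set x : B | (x.2 <= j)%R] : set T).
Proof.
rewrite (_ : mkset _ = [set x : T | x * point (j + 1)%R 1 (j + 1)%R <> x]).
  by apply: (@open_neq T T
    ( *%g^~ (point (j + 1)%R 1 (j + 1)%R)) id) => // x;
    exact: cvg_id.
apply/seteqP; split=> -[[a s] b] /=.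
  by move=> bj; rewrite ZBR_mul_lt ?ltzD1 //; case=> *; lia.
move=> ne; rewrite leNgt -lezD1; apply/negP => le1; apply: ne.
exact: mul_idem_le.
Qed.

Definition lower_diagonal (i j : int) : set B :=
  [set x : B | exists (k : nat) (s : S), x = (i - k%:Z, s, j - k%:Z)%R].

(** Let [(a, s, b)] satisfy [a <= i] and [b <= j].  Left multiplication by
    [(i, 1, i)] turns [b] into [b + (i - a)], and right multiplication by
    [(j, 1, j)] turns [a] into [a + (j - b)].  Bounding these by [j] and [i]
    forces [i - a = j - b]. *)
Lemma open_lower_diagonal (i j : int) : open (lower_diagonal i j : set T).
Proof.
pose F := [set x : B | (x.1.1 <= i)%R] `&` [set x : B | (x.2 <= j)%R].
have oF : open (F : set T).
  by apply: openI; [exact: open_fst_le|exact: open_snd_le].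
rewrite (_ : lower_diagonal i j =
  F `&` ([set x : B | F (point i 1 i * x)] `&`
         [set x : B | F (x * point j 1 j)])); last first.
  apply/seteqP; split=> -[[a s] b].
    move=> [[|k] [t [-> -> ->]]]; rewrite /F /= ?subr0.
      by rewrite idem_mul_le // mul_idem_le //=; lia.
    by rewrite ZBR_mul_gt ?ZBR_mul_lt //=; lia.
  move=> [[/= ai bj] []]; rewrite /F /=.
  move: ai bj; rewrite le_eqVlt => /predU1P[->|ai];
    rewrite le_eqVlt => /predU1P[->|bj].
  - by move=> _ _; exists 0%N, s; rewrite !subr0.
  - by move=> _; rewrite ZBR_mul_lt //=; lia.
  - by rewrite ZBR_mul_gt //=; lia.
  rewrite ZBR_mul_gt // (ZBR_mul_lt _ _ _ _ _ bj) /= => -[_ le1] [le2 _].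
  by exists `|i - a|%N, s; congr (_, _, _); lia.
apply: openI => //; apply: openI.
  by apply: (@open_comp T T) => // x _; exact: cl.
by apply: (@open_comp T T) => // x _; exact: cr.
Qed.

Section Block.
Variable m : int.
Hypothesis restr : restricts_to tau tauBR m.

(** The hypothesis speaks of the block [S_(m,m)] only; the shifts carry it to
    every other block. *)
Lemma continuous_point (i j : int) :
  continuous ((fun s => point i s j) : tspace tau -> T).
Proof.
have cm : continuous ((fun s => point m s m) : tspace tau -> T).
  apply/continuousP => U oU; apply/restr; exists U; split=> //.
  apply/seteqP; split=> x; first by case=> s Us <-; split => //; exists s.
  by case=> Ux [s xE]; exists s; rewrite /preimage /= -?xE.
have -> : (fun s => point i s j) =
    (fun s => point i 1 m * point m s m * point m 1 j).
  by apply/funext => s; rewrite !ZBR_mul_eq mul1g mulg1.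
exact: (@continuous_mul_sides (tspace tau) (fun s => point m s m)
  (point i 1 m) (point m 1 j) cm).
Qed.

Lemma open_block_trace (W : set B) (i j : int) : opens tauBR W ->
  opens tau [set s | W (i, s, j)].
Proof. by move=> oW; move/continuousP: (@continuous_point i j); exact. Qed.

Lemma open_block_of_slice (V : set S) (i j : int) :
  open (ZBR_block theta i j : set T) -> opens tau V ->
  opens tauBR [set point i s j | s in V].
Proof.
move=> oij /restr[U [oU VE]].
rewrite (_ : [set _ | _ in _] = ZBR_block theta i j `&`
  [set x | U (point m 1 i * x * point j 1 m)]).
  apply: openI => //.
  apply: (@open_comp T T (fun x => point m 1 i * x * point j 1 m)) => // x _.
  by apply: (@continuous_mul_sides T id) => y; exact: cvg_id.
have VU s : V s <-> U (m, s, m).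
  split=> [Vs|Us].
    have : (U `&` ZBR_block theta m m) (m, s, m) by rewrite -VE; exists s.
    by case.
  have : (U `&` ZBR_block theta m m) (m, s, m) by split => //; exists s.
  by rewrite -VE => -[t Vt [<-]].
apply/seteqP; split=> x.
  case=> s Vs <-; split; first by exists s.
  by rewrite /= !ZBR_mul_eq mul1g mulg1; apply/VU.
case=> -[s ->]; rewrite /= !ZBR_mul_eq mul1g mulg1 => /VU Vs.
by exists s.
Qed.

Lemma closed_point_image (I : set S) (i j : int) :
  compact (I : set (tspace tau)) ->
  closed ([set point i s j | s in I] : set T).
Proof.
move=> cI; apply: compact_closed => //.
apply: (@continuous_compact _ T (fun s : tspace tau => point i s j)) => //.
exact/continuous_subspaceT/continuous_point.
Qed.

(** A block is the top of its diagonal ray, so it is open once some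
    continuous map sends the rest of the ray, but no point of the block, into
    a closed set. *)
Lemma open_block_separated (f : B -> B) (K : set B) (i j : int) :
  continuous (f : T -> T) -> closed (K : set T) ->
  (forall s, ~ K (f (point i s j))) ->
  (forall (k : nat) s, K (f (point (i - k.+1%:Z)%R s (j - k.+1%:Z)%R))) ->
  open (ZBR_block theta i j : set T).
Proof.
move=> cf clK notK inK.
rewrite (_ : ZBR_block theta i j =
    lower_diagonal i j `&` [set x | (~` K) (f x)]).
  apply: openI; first exact: open_lower_diagonal.
  by apply: (@open_comp T T f); [move=> x _; exact: cf|exact: closed_openC].
apply/seteqP; split=> x.
  by move=> [s ->]; split; [exists 0%N, s; rewrite !subr0|exact: notK].
move=> [[[|k] [s ->]]]; first by rewrite !subr0 => _; exists s.
by move=> /(_ (inK k s)).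
Qed.

(** Right multiplication by [(j - 1, c, j - 1)] with [c] in the ideal sends the
    ray below [S_(i,j)] into the copy of the ideal in [S_(i-1,j-1)], and
    leaves [S_(i,j)] in itself. *)
Lemma open_block_left (I : set S) (i j : int) :
  left_ideal I -> compact (I : set (tspace tau)) ->
  open (ZBR_block theta i j : set T).
Proof.
move=> [[c Ic] SI] cI.
pose a := point (j - 1)%R c (j - 1)%R.
apply: (@open_block_separated ( *%g^~ a) _ i j (@cr a)
  (@closed_point_image I (i - 1)%R (j - 1)%R cI)) => [s|k s].
  by rewrite /a /= ZBR_mul_gt; [case=> t _ []; lia|lia].
case: k => [|k].
  by rewrite /= /a ZBR_mul_eq; exists (s * c); [exact: SI|].
rewrite /= /a ZBR_mul_lt; last by lia.
set u := theta_iter _ _ _.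
by exists (u * c); [exact: SI|congr (_, _, _); lia].
Qed.

Lemma open_block_right (I : set S) (i j : int) :
  right_ideal I -> compact (I : set (tspace tau)) ->
  open (ZBR_block theta i j : set T).
Proof.
move=> [[c Ic] SI] cI.
pose a := point (i - 1)%R c (i - 1)%R.
apply: (@open_block_separated ( *%g a) _ i j (@cl a)
  (@closed_point_image I (i - 1)%R (j - 1)%R cI)) => [s|k s].
  by rewrite /a /= ZBR_mul_lt; [case=> t _ []; lia|lia].
case: k => [|k].
  by rewrite /= /a ZBR_mul_eq; exists (c * s); [exact: SI|].
rewrite /= /a ZBR_mul_gt; last by lia.
set u := theta_iter _ _ _.
by exists (c * u); [exact: SI|congr (_, _, _); lia].
Qed.

End Block.
End Extension.

(** * Comparison with the direct sum topology *)

Lemma opens_direct_sumP (S : monoidType) (tau : Topological S)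
    (theta : {multiplicative S -> unit_group S})
    (W : set (ZBruckReilly theta)) :
  opens (direct_sum_topology theta tau) W <->
  forall i j : int, opens tau [set s | W (i, s, j)].
Proof.
pose P : topologicalType :=
  (discrete_topology int * tspace tau * discrete_topology int)%type.
rewrite /opens -[@open (tspace _)]/(@open P); split.
  move=> oW i j; rewrite openE => s Ws.
  have : nbhs ((i, s, j) : P) W by apply: open_nbhs_nbhs.
  case=> -[/= A C] [/= [[/= D E] [/= Di Es] DEA] Cj] ACW.
  apply: filterS Es => t Et.
  apply: (ACW (i, t, j)); split => /=; last exact: Cj.
  by apply: (DEA (i, t)); split => //=; exact: Di.
move=> oW; rewrite openE => -[[i s] j] Ws.
exists ([set i] `*` [set t | W (i, t, j)], [set j]) => /=.
  split; last by [].
  exists ([set i], [set t | W (i, t, j)]) => //=; split=> //.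
  by apply: open_nbhs_nbhs; split => //; exact: oW.
by move=> [[a t] b] /= [[-> Wt] ->].
Qed.

Theorem theorem2p4 (S : monoidType) (tau : Topological S)
    (theta : {multiplicative S -> unit_group S})
    (tauBR : Topological (ZBruckReilly theta)) :
  semitopological_semigroup tau ->
  continuous (theta : tspace tau -> unit_space tau) ->
  topological_ZBR_extension semitopological_semigroup tau tauBR ->
  (exists I : set S, (left_ideal I \/ right_ideal I \/ two_sided_ideal I) /\
     compact (I : set (tspace tau))) ->
  opens tauBR = opens (direct_sum_topology theta tau).
Proof.
move=> _ _ [_ _ semitopBR [m restr]] [I [idealI compactI]].
have oblock i j : open (ZBR_block theta i j : set (tspace tauBR)).
  case: idealI => [lI|[rI|[lI _]]].
  - exact: open_block_left restr _ _ _ lI compactI.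
  - exact: open_block_right restr _ _ _ rI compactI.
  - exact: open_block_left restr _ _ _ lI compactI.
apply/seteqP; split=> W.
  move=> oW; apply/opens_direct_sumP => i j.
  exact: open_block_trace restr _ _ _ oW.
move=> /opens_direct_sumP oW; rewrite /opens.
rewrite (_ : W = \bigcup_(ij in [set: int * int])
  [set ((ij.1, s, ij.2) : ZBruckReilly theta)
     | s in [set s | W (ij.1, s, ij.2)]]).
  apply: bigcup_open => -[i j] _.
  exact: open_block_of_slice restr _ _ _ (oblock i j) (oW i j).
apply/seteqP; split=> [[[i s] j] Ws|x [[i j] _ [s Ws <-]]] //.
by exists (i, j) => //; exists s.
Qed.
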